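(* Let $\mathcal{T}$ be a finite set of transactions. The following are equivalent: (1) $\mathcal{T}$ is not robust against RC; (2) there is a multiversion split schedule $s$ for $\mathcal{T}$ based on some sequence $C$ of conflict quadruples for $\mathcal{T}$.
   Context: **Tuples and operations.** A relational schema is a set $\mathsf{Rels}$ of relation names; each $R\in\mathsf{Rels}$ has a finite attribute set $\mathrm{Attr}(R)$ and an infinite set $\mathbf{Tuples}_R$ of abstract objects (tuples of type $R$), pairwise disjoint for different $R$; $\mathbf{Tuples}=\bigcup_R \mathbf{Tuples}_R$. On a tuple $t$ there are three kinds of operations: $\mathtt{R}[t]$ (read), $\mathtt{W}[t]$ (write), $\mathtt{U}[t]$ (atomic update: a read followed by a write, as a single atomic operation). A *read operation* is an $\mathtt{R}$- or $\mathtt{U}$-operation; a *write operation* is a $\mathtt{W}$- or $\mathtt{U}$-operation. Each operation $o$ on a tuple of type $R$ has sets $\mathrm{ReadSet}(o),\mathrm{WriteSet}(o)\subseteq \mathrm{Attr}(R)$, with $\mathrm{WriteSet}(o)=\emptyset$ for $\mathtt{R}$-operations and $\mathrm{ReadSet}(o)=\emptyset$ for $\mathtt{W}$-operations. There is also a commit operation $\mathtt{C}$. **Transactions.** A transaction $T$ is a finite sequence (linear order $\le_T$, strict version $<_T$) of read and write operations followed by a commit. A transaction performs at most one $\mathtt R$-, one $\mathtt W$- and one $\mathtt U$-operation per tuple. In a set $\mathcal{T}$ of transactions each transaction $T_i$ has a unique id $i$; operations of different transactions are distinct; $\mathtt{C}_i$ is the commit of $T_i$. **Schedules.** A (multiversion)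 schedule $s$ over $\mathcal{T}$ is a tuple $(O_s,\le_s,\ll_s,v_s)$: $O_s$ consists of all operations of transactions in $\mathcal{T}$ and a special operation $op_0$ (writing the initial versions of all tuples); $\le_s$ is a total order on $O_s$; $\ll_s$ (version order) gives for each tuple $t$ a total order on the write operations on $t$ in $s$; $v_s$ (version function) maps each read operation $a$ to $op_0$ or to a write operation different from $a$. Required: $op_0\le_s a$ for all $a\in O_s$; $op_0\ll_s a$ for every write operation $a$; $a<_T b$ implies $a<_s b$ for all $T\in\mathcal{T}$; for each read operation $a$, $v_s(a)<_s a$, and if $v_s(a)\neq op_0$ then $v_s(a)$ is on the same tuple as $a$. $s$ is a *single version schedule* if for all write operations $a,b$ on the same tuple $a\ll_s b$ iff $a<_s b$, and for every read operation $a$ there is no write operation $c$ on the same tuple with $v_s(a)<_s c<_s a$. It is *single version serial* if moreover $a<_s b<_s c$ with $a,c\in T$ implies $b\in T$, for all $T\in\mathcal{T}$. **Conflicts and serializability.** For operations $x,y$ on the same tuple from different transactions: $x$ is *ww-conflicting* with $y$ if $\mathrm{WriteSet}(x)\cap\mathrm{WriteSet}(y)\ne\emptyset$; *wr-conflicting* with $y$ if $\mathrm{WriteSet}(x)\cap\mathrm{ReadSet}(y)\neq\emptyset$; *rw-conflicting* with $y$ if $\mathrm{ReadSet}(x)\cap\mathrm{WriteSet}(y)\ne\emptyset$; *conflicting* if at least one of these holds. Commits and $op_0$ conflict with nothing. For conflicting $b_i\in T_i$, $a_j\in T_j$, write $b_i\to_s a_j$ if: $b_i$ is ww-conflicting with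 $a_j$ and $b_i\ll_s a_j$; or $b_i$ is wr-conflicting with $a_j$ and ($b_i=v_s(a_j)$ or $b_i\ll_s v_s(a_j)$); or $b_i$ is rw-conflicting with $a_j$ and $v_s(b_i)\ll_s a_j$. Two schedules $s,s'$ over the same $\mathcal{T}$ are *conflict equivalent* if for all conflicting $a_j,b_i$: $b_i\to_s a_j$ iff $b_i\to_{s'}a_j$. $s$ is *conflict serializable* if it is conflict equivalent to a single version serial schedule. **RC and robustness.** $s$ *exhibits a dirty write* if there are ww-conflicting $b_i\in T_i$, $a_j\in T_j$, $T_i\ne T_j$, with $b_i<_s a_j<_s\mathtt{C}_i$. $\ll_s$ *corresponds to the commit order* if for all write operations $b_i\in T_i$, $a_j\in T_j$ on the same tuple with $T_i\neq T_j$: $b_i\ll_s a_j$ iff $\mathtt{C}_i<_s\mathtt{C}_j$. $s$ is *read-last-committed* if $\ll_s$ corresponds to the commit order and for every read operation $a_j$ on a tuple $t$: (i) $v_s(a_j)=op_0$, or $v_s(a_j)\in T_i$ with $\mathtt{C}_i<_s a_j$; and (ii) there is no write operation $c_k\in T_k$ on $t$ with $\mathtt{C}_k<_s a_j$ and $v_s(a_j)\ll_s c_k$. $s$ is *allowed under RC* (multiversion read committed) if it is read-last-committed and exhibits no dirty write. $\mathcal{T}$ is *robust against RC* if every schedule over $\mathcal{T}$ allowed under RC is conflict serializable. **Multiversion split schedules.** A *conflict quadruple* for $\mathcal{T}$ is $(T_i,b_i,a_j,T_j)$ with $T_i,T_j\in\mathcal{T}$ different and $b_i\in T_i$, $a_j\in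 T_j$ conflicting. For $b\in T$, $\mathsf{prefix}_b(T)$ is the restriction of $T$ to operations $\le_T b$, and $\mathsf{postfix}_b(T)$ the restriction to operations strictly after $b$. Let $C=(T_1,b_1,a_2,T_2),(T_2,b_2,a_3,T_3),\ldots,(T_m,b_m,a_1,T_1)$ be a sequence of conflict quadruples for $\mathcal{T}$ such that each transaction in $\mathcal{T}$ occurs in at most two quadruples. A *multiversion split schedule for $\mathcal{T}$ based on $C$* is a multiversion schedule over $\mathcal{T}$ whose operation order (after $op_0$) has the form $$\mathsf{prefix}_{b_1}(T_1)\cdot T_2\cdots T_m\cdot \mathsf{postfix}_{b_1}(T_1)\cdot T_{m+1}\cdots T_n,$$ where (1) no write operation in $\mathsf{prefix}_{b_1}(T_1)$ is ww-conflicting with a write operation in any of $T_2,\ldots,T_m$; (2) $b_1<_{T_1}a_1$ or $b_m$ is rw-conflicting with $a_1$; (3) $b_1$ is rw-conflicting with $a_2$; and $T_{m+1},\ldots,T_n$ are the remaining transactions of $\mathcal{T}$ (those not mentioned in $C$) in arbitrary order. *)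

(* Defs.v *)
From HB Require Import structures.
From mathcomp Require Import all_boot finmap.
From mathcomp Require Import classical_sets cardinality.

Set Implicit Arguments.
Unset Strict Implicit.
Unset Printing Implicit Defensive.

(* The sets Tuples_R are the fibres of [type_of], hence pairwise disjoint. *)
Record schema := Schema {
  relname : Type;
  attribute : choiceType;
  Attr : relname -> {fset attribute};
  tuple : eqType;
  type_of : tuple -> relname;
  Tuples_infinite : forall R : relname,
    infinite_set [set t | type_of t = R]%classic }.

Inductive op_kind := KR | KW | KU.

Definition op_kind_eqb (x y : op_kind) : bool :=
  match x, y with KR, KR | KW, KW | KU, KU => true | _, _ => false end.

Lemma op_kind_eqP : Equality.axiom op_kind_eqb.
Proof. by case; case; constructor. Qed.

HB.instance Definition _ := hasDecEq.Build op_kind op_kind_eqP.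

Record operation (S : schema) := Operation {
  kind : op_kind;
  tup : tuple S;
  ReadSet : {fset attribute S};
  WriteSet : {fset attribute S};
  ReadSet_Attr : (ReadSet `<=` Attr (type_of tup))%fset;
  WriteSet_Attr : (WriteSet `<=` Attr (type_of tup))%fset;
  WriteSet_R : kind = KR -> WriteSet = fset0;
  ReadSet_W : kind = KW -> ReadSet = fset0 }.

(* The final commit is not stored in [ops]; see [action]. *)
Record transaction (S : schema) := Transaction {
  ops : seq (operation S);
  ops_once : uniq [seq (kind o, tup o) | o <- ops] }.

(* A finite set of transactions is a family [T] indexed by a finite type [I] of
   transaction ids. Its operations are the pairs (i, k) of an id and a
   position in T_i, where the last position, [size (ops (T i))], is the commit
   C_i; thus operations of different transactions are distinct. *)
Section Operations.
Variables (S : schema) (I : finType) (T : I -> transaction S).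

Definition action := {i : I & 'I_(size (ops (T i))).+1}.

(* The set O_s, with [None] for op_0. *)
Definition event : Type := option action.

Definition op0 : event := None.

Definition event_at (i : I) (k : 'I_(size (ops (T i))).+1) : event :=
  Some (Tagged (fun i => 'I_(size (ops (T i))).+1) k).

Definition commit (i : I) : event := event_at (@ord_max (size (ops (T i)))).

(* [None] on op_0 and on commits. *)
Definition body (x : event) : option (operation S) :=
  if x is Some a then onth (ops (T (tag a))) (tagged a) else None.

Definition in_trans (i : I) (x : event) : bool :=
  if x is Some a then tag a == i else false.

Definition is_read (x : event) : bool :=
  if body x is Some o then (kind o == KR) || (kind o == KU) else false.

Definition is_write (x : event) : bool :=
  if body x is Some o then (kind o == KW) || (kind o == KU) else false.

Definition on_tuple (t : tuple S) (x : event) : bool :=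
  if body x is Some o then tup o == t else false.

Definition same_tuple (x y : event) : bool :=
  if body x is Some o then on_tuple (tup o) y else false.

Definition rset (x : event) : {fset attribute S} :=
  if body x is Some o then ReadSet o else fset0.

Definition wset (x : event) : {fset attribute S} :=
  if body x is Some o then WriteSet o else fset0.

Definition le_T (x y : event) : bool :=
  if x is Some a then
    if y is Some b then (tag a == tag b) && (tagged a <= tagged b) else false
  else false.

Definition lt_T (x y : event) : bool := (x != y) && le_T x y.

Definition T_seq (i : I) : seq event := [seq event_at k | k : 'I_(size (ops (T i))).+1].

Definition prefix_T (b : event) (i : I) : seq event :=
  [seq x <- T_seq i | le_T x b].

Definition postfix_T (b : event) (i : I) : seq event :=
  [seq x <- T_seq i | lt_T b x].

Definition diff_trans (x y : event) : bool :=
  if x is Some a then if y is Some b then tag a != tag b else false else false.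

Definition ww_conflict (x y : event) : bool :=
  [&& diff_trans x y, same_tuple x y & (wset x `&` wset y)%fset != fset0].

Definition wr_conflict (x y : event) : bool :=
  [&& diff_trans x y, same_tuple x y & (wset x `&` rset y)%fset != fset0].

Definition rw_conflict (x y : event) : bool :=
  [&& diff_trans x y, same_tuple x y & (rset x `&` wset y)%fset != fset0].

Definition conflicting (x y : event) : bool :=
  [|| ww_conflict x y, wr_conflict x y | rw_conflict x y].

(* op_0 writes the initial version of every tuple, so it takes part in the
   version order of every tuple. *)
Definition writes_version (t : tuple S) (x : event) : bool :=
  (x == op0) || (is_write x && on_tuple t x).

(* [vlt] is the version order, a strict total order on the versions of each
   tuple, and [vf] the version function. Only the values of [vlt] on versions
   of one tuple, and those of [vf] on read operations, are meaningful. *)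
Record schedule := Schedule {
  le_s : rel event;
  vlt : rel event;
  vf : event -> event;
  le_s_refl : reflexive le_s;
  le_s_anti : antisymmetric le_s;
  le_s_trans : transitive le_s;
  le_s_total : total le_s;
  vlt_irr : forall t, {in writes_version t, irreflexive vlt};
  vlt_trans : forall t, {in writes_version t & &, transitive vlt};
  vlt_total : forall t,
    {in writes_version t &, forall a b, a != b -> vlt a b || vlt b a};
  le_s_op0 : forall a, le_s op0 a;
  vlt_op0 : forall a, is_write a -> vlt op0 a;
  le_s_T : forall a b, lt_T a b -> (a != b) && le_s a b;
  vf_lt : forall a, is_read a -> (vf a != a) && le_s (vf a) a;
  vf_write : forall a, is_read a -> vf a != op0 ->
    is_write (vf a) && same_tuple (vf a) a }.

Definition lt_s (s : schedule) (a b : event) : bool := (a != b) && le_s s a b.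

Definition single_version (s : schedule) : Prop :=
  (forall a b, is_write a -> is_write b -> same_tuple a b ->
     vlt s a b = lt_s s a b) /\
  (forall a, is_read a ->
     ~ exists c, [&& is_write c, same_tuple c a, lt_s s (vf s a) c & lt_s s c a]).

Definition single_version_serial (s : schedule) : Prop :=
  single_version s /\
  (forall i a b c, lt_s s a b -> lt_s s b c ->
     in_trans i a -> in_trans i c -> in_trans i b).

(* b ->_s a. *)
Definition dep (s : schedule) (b a : event) : bool :=
  [|| ww_conflict b a && vlt s b a,
      wr_conflict b a && ((b == vf s a) || vlt s b (vf s a))
    | rw_conflict b a && vlt s (vf s b) a].

Definition conflict_equivalent (s s' : schedule) : Prop :=
  forall b a, conflicting b a -> dep s b a = dep s' b a.

Definition conflict_serializable (s : schedule) : Prop :=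
  exists2 s', single_version_serial s' & conflict_equivalent s s'.

Definition exhibits_dirty_write (s : schedule) : Prop :=
  exists i b a, [&& in_trans i b, ww_conflict b a, lt_s s b a
                  & lt_s s a (commit i)].

Definition version_order_is_commit_order (s : schedule) : Prop :=
  forall i j b a, i != j -> in_trans i b -> in_trans j a ->
    is_write b -> is_write a -> same_tuple b a ->
    vlt s b a = lt_s s (commit i) (commit j).

Definition read_last_committed (s : schedule) : Prop :=
  version_order_is_commit_order s /\
  (forall a, is_read a ->
     (vf s a = op0 \/
      exists2 i, in_trans i (vf s a) & lt_s s (commit i) a) /\
     ~ (exists k c, [&& is_write c, same_tuple c a, in_trans k c,
                        lt_s s (commit k) a & vlt s (vf s a) c])).

Definition allowed_RC (s : schedule) : Prop :=
  read_last_committed s /\ ~ exhibits_dirty_write s.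

Definition robust_RC : Prop :=
  forall s : schedule, allowed_RC s -> conflict_serializable s.

(* (T_i, b_i, a_j, T_j) *)
Record quadruple := Quadruple {
  src : I;
  opb : event;
  opa : event;
  tgt : I;
  src_neq_tgt : src != tgt;
  opb_src : in_trans src opb;
  opa_tgt : in_trans tgt opa;
  quad_conflict : conflicting opb opa }.

(* The sequence (T_1,b_1,a_2,T_2), ..., (T_m,b_m,a_1,T_1), closing up
   cyclically, in which every transaction occurs at most twice. *)
Definition quad_sequence (C : seq quadruple) : Prop :=
  cycle (fun q q' => tgt q == src q') C /\
  (forall i, count (fun q => (src q == i) || (tgt q == i)) C <= 2).

(* O_s listed in the order <=_s. *)
Definition op_sequence (s : schedule) : seq event :=
  sort (le_s s) (enum {: event}).

(* [C = q1 :: C'] so that [map src C'] is T_2, ..., T_m, [opa q1] is a_2, and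
   b_m, a_1 are found in the last quadruple [qm]; [others] is
   T_(m+1), ..., T_n. *)
Definition split_schedule (C : seq quadruple) (s : schedule) : Prop :=
  if C is q1 :: C' then
    let qm := last q1 C' in
    let T1 := src q1 in
    let b1 := opb q1 in
    let middle := map src C' in
    [/\ quad_sequence C,
        exists others : seq I,
          [/\ uniq others,
              forall i, (i \in others) = (i \notin map src C)
            & op_sequence s =
                op0 :: prefix_T b1 T1 ++ flatten (map T_seq middle)
                    ++ postfix_T b1 T1 ++ flatten (map T_seq others)],
        forall c k d, c \in prefix_T b1 T1 -> is_write c ->
          k \in middle -> in_trans k d -> is_write d -> ~~ ww_conflict c d,
        lt_T b1 (opa qm) || rw_conflict (opb qm) (opa qm)
      & rw_conflict b1 (opa q1)]
  else False.

End Operations.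

(* Main.v *)
(* Under RC, b ->_s a holds iff C_b < C_a (ww), C_b < a (wr) or b < C_a (rw),
   and in a single version schedule it holds iff b < a. Hence an RC schedule is
   conflict serializable iff the dependencies between its transactions are
   acyclic: a topological order gives the serial schedule.

   Given a shortest cycle, let T_2 be its transaction that commits first and T_1
   the predecessor of T_2. Only an rw-dependency can lead from T_1 to
   the earlier committing T_2, so b_1 < C_2. If a write of prefix_{b_1}(T_1) were
   ww-conflicting with one of T_k, then, there being no dirty writes, T_1 would
   commit before T_k, so k <> 2 and T_1 -> T_k would be a chord of the cycle.
   This is condition (1), and condition (2) follows from it in the same way.

   Conversely, the operation order of a split schedule, completed by the commit
   order and the last committed versions, is allowed under RC and makes C a
   cycle of dependencies. *)
From HB Require Import structures.
Require Import Defs.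
From mathcomp Require Import ssreflect ssrfun ssrbool eqtype seq fintype.
From mathcomp Require Import all_boot finmap boolp zify.

Set Implicit Arguments.
Unset Strict Implicit.
Unset Printing Implicit Defensive.

(** Packs a lexicographic order into one number. The version keys, the serial order and the
    topological numbering below are all built this way. *)
Lemma ltn_lex N a b c d : b < N -> d < N ->
  (a * N + b < c * N + d) = (a < c) || (a == c) && (b < d).
Proof.
move=> bN dN; case: (ltngtP a c) => [ac|ca|->] /=; last by rewrite ltn_add2l.
- have : a.+1 * N <= c * N by rewrite leq_mul2r ac orbT.
  by rewrite mulSn; lia.
- have : c.+1 * N <= a * N by rewrite leq_mul2r ca orbT.
  by rewrite mulSn; lia.
Qed.

Lemma nonuniq_split (K : eqType) (c : seq K) : ~~ uniq c ->
  exists x p1 p2 p3, c = p1 ++ x :: p2 ++ x :: p3.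
Proof.
elim: c => //= y c IH.
have [yc _|_ /= /IH[x [p1 [p2 [p3 ->]]]]] := boolP (y \in c).
  by case/splitPr: yc => p2 p3; exists y, [::], p2, p3.
by exists x, (y :: p1), p2, p3.
Qed.

(** * Shortest cycles *)

Section ShortestCycle.
Variables (K : finType) (e : rel K).

Definition shortest_cycle (c : seq K) : Prop :=
  [/\ cycle e c, c != [::]
    & forall c', cycle e c' -> c' != [::] -> size c <= size c'].

Lemma shortest_cycle_exists x y : e x y -> connect e y x ->
  exists c, shortest_cycle c.
Proof.
move=> xy /connectP[p pp px].
pose P n := (0 < n) && [exists c : n.-tuple K, cycle e c].
have exP : exists n, P n.
  exists (size (y :: p)); apply/existsP; exists (in_tuple (y :: p)).
  by rewrite /= rcons_path pp -px.
case: (ex_minnP exP) => n /andP[n0 /existsP[c cc]] cmin.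
exists c; split=> // [|c' cc' c'0]; first by rewrite -size_eq0 size_tuple -lt0n.
rewrite size_tuple; apply: cmin; rewrite /P lt0n size_eq0 c'0.
by apply/existsP; exists (in_tuple c').
Qed.

Lemma shortest_cycle_rot n c : shortest_cycle c -> shortest_cycle (rot n c).
Proof.
case=> cc c0 cmin; split; first by rewrite rot_cycle.
  by rewrite -size_eq0 size_rot size_eq0.
by move=> c' ? ?; rewrite size_rot; apply: cmin.
Qed.

(** With a repeated vertex rotated to the front, the stretch up to its second occurrence is itself a
    cycle, and a shorter one. *)
Lemma shortest_cycle_uniq c : shortest_cycle c -> uniq c.
Proof.
move=> sc; apply/negPn/negP=> /nonuniq_split[x [p1 [p2 [p3 ec]]]].
have := shortest_cycle_rot (size p1) sc; rewrite ec rot_size_cat /=.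
case=> /= cyc _ /(_ (x :: p2)) min.
move: cyc; rewrite -catA rcons_cat cat_path /= => /and3P[px2 ex _].
by move: min; rewrite /= rcons_path px2 ex /= !size_cat /= => /(_ isT isT); lia.
Qed.

(** The edge [e x y] bypasses [p], so dropping [p] leaves a cycle. *)
Lemma shortest_cycle_chord x p y q :
  shortest_cycle (x :: p ++ y :: q) -> e x y -> p = [::].
Proof.
case=> cyc _ /(_ (x :: y :: q)) min xy.
move: cyc; rewrite /= rcons_cat cat_path /= => /and3P[_ _ pyq].
move: min; rewrite /= xy pyq !size_cat /= => /(_ isT isT).
by case: p => //= z p; lia.
Qed.

(** Rotation puts a vertex with minimal [F] second and its predecessor first; irreflexivity excludes
    a cycle of length one, where the two would coincide. *)
Lemma shortest_cycle_min (F : K -> nat) c : irreflexive e -> shortest_cycle c ->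
  exists x y p, shortest_cycle [:: x, y & p] /\
    {in [:: x, y & p], forall z, F y <= F z}.
Proof.
move=> e_irr sc; have [_ + _] := sc; case: c sc => // z0 c sc _.
have [z zc zmin] := arg_minnP F (mem_head z0 c).
have [n p def_c] := rot_to zc.
have memE u : u \in z :: p -> u \in z0 :: c by rewrite -def_c mem_rot.
have {sc} := shortest_cycle_rot n sc; rewrite def_c.
case/lastP: p memE {def_c} => [_ [/= + _ _]|p x memE]; first by rewrite e_irr.
move/(shortest_cycle_rot (size (rcons (z :: p) x) - 1)).
rewrite -rcons_cons -/(rotr 1 _) rotr1_rcons => sc.
exists x, z, p; split=> // u ux.
apply/zmin/memE; move: ux; rewrite !inE mem_rcons inE.
by case: (u == x); case: (u == z).
Qed.

End ShortestCycle.

(** * Events, transactions and conflicts *)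

Section Robustness.
Variables (S : schema) (I : finType) (T : I -> transaction S).

Notation event := (event T).
Implicit Types (a b c x y : event) (i j k : I) (s : schedule T).

(** Sending [op0] to itself lets this map serve as the [f] of [schedule_of_rank], which must fix
    [op0]. *)
Definition commit_of x : event :=
  if x is Some u then commit T (tag u) else op0 T.

Lemma commit_of_trans i x : in_trans i x -> commit_of x = commit T i.
Proof. by case: x => //= u /eqP ->. Qed.

Lemma in_trans_commit i : in_trans i (commit T i).
Proof. exact: eqxx. Qed.

Lemma commit_inj : injective (commit T).
Proof. by move=> i j /(congr1 (in_trans i)); rewrite /= eqxx => /esym/eqP. Qed.

Lemma body_commit_of x : body (commit_of x) = None.
Proof. by case: x => //= u; rewrite onthE nth_default // size_map. Qed.

Lemma le_commit_of x : x != op0 T -> le_T x (commit_of x).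
Proof. by case: x => //= u _; rewrite eqxx /= -ltnS. Qed.

Lemma lt_TP x y : lt_T x y ->
  exists i (k l : 'I_(size (ops (T i))).+1),
    [/\ x = event_at k, y = event_at l & k < l].
Proof.
case: x y => [[i k]|] [[j l]|]; rewrite /lt_T ?andbF //=.
case/and3P=> ne /eqP /= e kl; subst j; exists i, k, l; split=> //.
by rewrite ltn_neqAle kl andbT; apply: contraNneq ne => /val_inj ->.
Qed.

Lemma lt_T_event_at i (k l : 'I_(size (ops (T i))).+1) :
  lt_T (event_at k) (event_at l) = (k < l).
Proof.
rewrite /lt_T /= eqxx ltn_neqAle; congr (~~ _ && _).
by rewrite /event_at (inj_eq Some_inj) eq_Tagged.
Qed.

Lemma diff_transE x y :
  diff_trans x y =
  [&& x != op0 T, y != op0 T & commit_of x != commit_of y].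
Proof. by case: x y => [u|] [v|] //=; rewrite (inj_eq commit_inj). Qed.

Lemma diff_trans_sym x y : diff_trans x y = diff_trans y x.
Proof. by rewrite !diff_transE andbCA (eq_sym (commit_of x)). Qed.

Lemma in_trans_diff i j x y :
  in_trans i x -> in_trans j y -> diff_trans x y = (i != j).
Proof. by case: x y => [u|] [v|] //= /eqP <- /eqP <-. Qed.

Lemma on_tuple_same t x y : on_tuple t x -> same_tuple x y -> on_tuple t y.
Proof.
by rewrite /same_tuple {1}/on_tuple; case: (body x) => // o /eqP ->.
Qed.

Lemma same_tuple_sym x y : same_tuple x y = same_tuple y x.
Proof.
by rewrite /same_tuple /on_tuple; case: (body x) (body y) => [o|] [p|].
Qed.

Lemma same_tuple_trans x y z :
  same_tuple x y -> same_tuple y z -> same_tuple x z.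
Proof.
by rewrite {1 3}/same_tuple; case: (body x) => // o; apply: on_tuple_same.
Qed.

(** The axioms on [vlt] are stated per tuple; this supplies the tuple at which to apply them. *)
Lemma write_version x : is_write x -> exists t,
  forall y, is_write y -> same_tuple x y -> y \in writes_version t.
Proof.
move=> wx; move: (wx); rewrite {1}/is_write; case ex: (body x) => [o|//] _.
exists (tup o) => y wy; rewrite /same_tuple ex => oy.
by rewrite unfold_in wy oy orbT.
Qed.

Lemma op0_version t : op0 T \in writes_version t.
Proof. by rewrite unfold_in eqxx. Qed.

Lemma same_tuple_refl x : body x -> same_tuple x x.
Proof. by rewrite /same_tuple /on_tuple; case: (body x) => // o _. Qed.

Lemma write_body x : is_write x -> body x.
Proof. by rewrite /is_write; case: (body x). Qed.

Lemma read_body x : is_read x -> body x.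
Proof. by rewrite /is_read; case: (body x). Qed.

Lemma wset_write x : wset x != fset0 -> is_write x.
Proof.
rewrite /wset /is_write; case: (body x) => [o|]; last by rewrite eqxx.
by have := @WriteSet_R _ o; case: (kind o) => // -> //; rewrite eqxx.
Qed.

Lemma rset_read x : rset x != fset0 -> is_read x.
Proof.
rewrite /rset /is_read; case: (body x) => [o|]; last by rewrite eqxx.
by have := @ReadSet_W _ o; case: (kind o) => // -> //; rewrite eqxx.
Qed.

Lemma fsetI_neq0 (K : choiceType) (A B : {fset K}) :
  (A `&` B)%fset != fset0 -> A != fset0 /\ B != fset0.
Proof.
by move=> h; split; apply: contraNneq h => ->; rewrite ?fset0I ?fsetI0.
Qed.

Lemma ww_conflictP x y : ww_conflict x y ->
  [/\ diff_trans x y, same_tuple x y, is_write x & is_write y].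
Proof. by case/and3P=> -> -> /fsetI_neq0[/wset_write -> /wset_write ->]. Qed.

Lemma wr_conflictP x y : wr_conflict x y ->
  [/\ diff_trans x y, same_tuple x y, is_write x & is_read y].
Proof. by case/and3P=> -> -> /fsetI_neq0[/wset_write -> /rset_read ->]. Qed.

Lemma rw_conflictP x y : rw_conflict x y ->
  [/\ diff_trans x y, same_tuple x y, is_read x & is_write y].
Proof. by case/and3P=> -> -> /fsetI_neq0[/rset_read -> /wset_write ->]. Qed.

Lemma ww_conflict_sym x y : ww_conflict x y = ww_conflict y x.
Proof. by rewrite /ww_conflict diff_trans_sym same_tuple_sym fsetIC. Qed.

Lemma wr_rw_conflict x y : wr_conflict x y = rw_conflict y x.
Proof.
by rewrite /wr_conflict /rw_conflict diff_trans_sym same_tuple_sym fsetIC.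
Qed.

Lemma conflictingP x y : conflicting x y ->
  [/\ diff_trans x y, body x & body y].
Proof.
case/or3P=> [/ww_conflictP|/wr_conflictP|/rw_conflictP] [-> _ hx hy].
- by rewrite !write_body.
- by rewrite write_body ?read_body.
- by rewrite read_body ?write_body.
Qed.

Lemma conflicting_sym x y : conflicting x y = conflicting y x.
Proof.
rewrite /conflicting ww_conflict_sym !wr_rw_conflict.
by rewrite (orbC (rw_conflict y x)).
Qed.

(** * Dependencies in a schedule *)

Section Schedule.
Variable s : schedule T.

Definition rank x := index x (op_sequence s).

Lemma mem_op_sequence x : x \in op_sequence s.
Proof. by rewrite mem_sort mem_enum. Qed.

Lemma op_sequence_uniq : uniq (op_sequence s).
Proof. by rewrite sort_uniq enum_uniq. Qed.

Lemma rank_inj : injective rank.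
Proof. by move=> x y; apply: (index_inj x); apply: mem_op_sequence. Qed.

Lemma le_rank x y : le_s s x y = (rank x <= rank y).
Proof.
have H u v : rank u <= rank v -> le_s s u v.
  apply: (sorted_leq_index (@le_s_trans _ _ _ s) (@le_s_refl _ _ _ s)).
  - exact/sort_sorted/le_s_total.
  - exact: mem_op_sequence.
  - exact: mem_op_sequence.
apply/idP/idP=> [xy|]; last exact: H.
case: leqP => // lt_yx; have yx := H _ _ (ltnW lt_yx).
suff e : x = y by rewrite e ltnn in lt_yx.
by apply: (@le_s_anti _ _ _ s); rewrite xy yx.
Qed.

Lemma lt_rank x y : lt_s s x y = (rank x < rank y).
Proof.
by rewrite /lt_s le_rank ltn_neqAle (inj_eq rank_inj).
Qed.

Lemma rank_op0 x : rank (op0 T) <= rank x.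
Proof. by rewrite -le_rank le_s_op0. Qed.

Lemma rank_lt_T x y : lt_T x y -> rank x < rank y.
Proof. by rewrite -lt_rank; apply: le_s_T. Qed.

Lemma rank_commit x : rank x <= rank (commit_of x).
Proof.
have [->|x0] := eqVneq x (op0 T); first exact: rank_op0.
have [e|ne] := eqVneq x (commit_of x); first by rewrite -e.
by apply/ltnW/rank_lt_T; rewrite /lt_T ne le_commit_of.
Qed.

Lemma lt_op0_s x : x != op0 T -> lt_s s (op0 T) x.
Proof. by move=> x0; rewrite /lt_s eq_sym x0 le_s_op0. Qed.

Lemma vlt_op0r x : is_write x -> vlt s x (op0 T) = false.
Proof.
move=> wx; apply/negP=> h; have [t ht] := write_version wx.
have xt : x \in writes_version t.
  by apply: ht => //; apply/same_tuple_refl/write_body.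
have h0 := op0_version t.
have := vlt_trans h0 xt xt h (vlt_op0 s wx).
by rewrite (vlt_irr s xt).
Qed.

Lemma vlt_total_write x y : is_write x -> is_write y -> same_tuple x y ->
  x != y -> vlt s x y || vlt s y x.
Proof.
move=> wx wy xy; have [t ht] := write_version wx.
apply: (vlt_total s _ (ht y wy xy)).
by apply: ht => //; apply/same_tuple_refl/write_body.
Qed.

Lemma vf_cases x : is_read x ->
  vf s x = op0 T \/ is_write (vf s x) /\ same_tuple (vf s x) x.
Proof.
move=> rx; have [->|ne] := eqVneq (vf s x) (op0 T); first by left.
by right; apply/andP; apply: vf_write.
Qed.

Lemma write_neq_op0 x : is_write x -> x != op0 T.
Proof. by case: x. Qed.

(** Versions are ordered as they are written, and no write on the tuple lies between a read and the
    version it reads. Comparing a write with that version is therefore the same as comparing it with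
    the read. *)
Lemma dep_single x y : single_version s -> conflicting x y ->
  dep s x y = lt_s s x y.
Proof.
case=> vS rS; have rS' a c : is_read a -> is_write c -> same_tuple c a ->
    lt_s s c a -> ~~ lt_s s (vf s a) c.
  move=> ra wc ca lca; apply/negP=> h; apply: (rS a ra); exists c.
  by rewrite wc ca h lca.
move=> cxy.
have Hww : ww_conflict x y -> vlt s x y = lt_s s x y.
  by case/ww_conflictP=> _ xy wx wy; apply: vS.
have Hwr : wr_conflict x y -> (x == vf s y) || vlt s x (vf s y) = lt_s s x y.
  case/wr_conflictP=> _ xy wx ry.
  have /andP[vne vle] := vf_lt s ry.
  have vlty : lt_s s (vf s y) y by rewrite /lt_s vne.
  have := rS' y x ry wx xy.
  have [v0|[wv vy]] := vf_cases ry.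
    rewrite v0 vlt_op0r // orbF (negPf (write_neq_op0 wx)).
    by rewrite lt_op0_s ?write_neq_op0 //; case: lt_s => // /(_ isT).
  have xv : same_tuple x (vf s y).
    by apply: same_tuple_trans xy _; rewrite same_tuple_sym.
  move: vlty; rewrite vS // !lt_rank -(inj_eq rank_inj) -leq_eqVlt -leqNgt.
  move=> vlty h; apply/idP/idP=> [|/h //]; by move/leq_ltn_trans; apply.
have Hrw : rw_conflict x y -> vlt s (vf s x) y = lt_s s x y.
  case/rw_conflictP=> xny xy rx wy.
  have /andP[vne vle] := vf_lt s rx.
  have := rS' x y rx wy; rewrite same_tuple_sym => /(_ xy).
  have ne : rank x != rank y.
    apply/eqP=> /rank_inj e; move: xny.
    by rewrite e diff_transE eqxx !andbF.
  have vltx : lt_s s (vf s x) x by rewrite /lt_s vne.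
  have [v0|[wv vx]] := vf_cases rx.
    rewrite v0 vlt_op0 // lt_op0_s ?write_neq_op0 // !lt_rank.
    by case: ltngtP ne => // _ _ /(_ isT).
  have vy : same_tuple (vf s x) y by apply: same_tuple_trans xy.
  move: vltx; rewrite vS // !lt_rank => vltx h; apply/idP/idP=> [h'|].
    by case: ltngtP ne h => // _ _ /(_ isT); rewrite h'.
  exact: ltn_trans.
(* Every kind of conflict that holds contributes the same truth value, and at least one kind
   holds. *)
move: cxy; rewrite /conflicting /dep.
case: (ww_conflict x y) Hww => [/(_ isT) ->|_];
case: (wr_conflict x y) Hwr => [/(_ isT) ->|_];
by case: (rw_conflict x y) Hrw => [/(_ isT) ->|_]; rewrite //= ?orbF ?orbb.
Qed.

(* Under read-last-committed, dependencies are read off the operation order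
   alone, whatever the order of two versions written by one transaction. *)
Lemma dep_read_committed x y : read_last_committed s ->
  dep s x y = [|| ww_conflict x y && lt_s s (commit_of x) (commit_of y),
                  wr_conflict x y && lt_s s (commit_of x) y
                | rw_conflict x y && lt_s s x (commit_of y)].
Proof.
case=> vC rC.
have vC' a b : diff_trans a b -> is_write a -> is_write b -> same_tuple a b ->
    vlt s a b = lt_s s (commit_of a) (commit_of b).
  by case: a b => [u|] [v|] //= uv wu wv; apply: vC uv _ _ wu wv; apply: eqxx.
have r1 a : is_read a -> is_write (vf s a) -> lt_s s (commit_of (vf s a)) a.
  move=> /rC[[->|[i /commit_of_trans -> //]] _].
  by rewrite /is_write.
have r2 a c : is_read a -> is_write c -> same_tuple c a ->
    lt_s s (commit_of c) a -> ~~ vlt s (vf s a) c.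
  move=> ra wc ca ca' ; apply/negP=> h; case: (rC a ra) => _; case.
  by case: c wc ca ca' h => // u wc ca ca' h; exists (tag u), (Some u);
    rewrite wc ca h /= eqxx andbT.
have Hww : ww_conflict x y -> vlt s x y = lt_s s (commit_of x) (commit_of y).
  by case/ww_conflictP=> *; apply: vC'.
have Hwr : wr_conflict x y ->
    (x == vf s y) || vlt s x (vf s y) = lt_s s (commit_of x) y.
  case/wr_conflictP=> _ xy wx ry; apply/idP/idP.
    case/orP=> [/eqP e|h]; first by rewrite {1}e r1 // -e.
    have [v0|[wv vy]] := vf_cases ry; first by rewrite v0 vlt_op0r in h.
    have := r1 y ry wv.
    have [d|] := boolP (diff_trans x (vf s y)).
      rewrite vC' // in h; last first.
        by apply: same_tuple_trans xy _; rewrite same_tuple_sym.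
      by move: h; rewrite !lt_rank; apply: ltn_trans.
    (* Here [x] and the version read by [y] belong to one transaction and share its commit. *)
    rewrite diff_transE !write_neq_op0 //= negbK => /eqP ->.
    by rewrite lt_rank.
  move=> h; have nv := r2 y x ry wx xy h.
  have [//|ne] := eqVneq x (vf s y).
  have [v0|[wv vy]] := vf_cases ry; first by rewrite v0 vlt_op0 in nv.
  have xv : same_tuple x (vf s y).
    by apply: same_tuple_trans xy _; rewrite same_tuple_sym.
  have := vlt_total_write wx wv xv ne; by rewrite (negPf nv) orbF.
have Hrw : rw_conflict x y -> vlt s (vf s x) y = lt_s s x (commit_of y).
  case/rw_conflictP=> _ xy rx wy; apply/idP/idP.
    (* If [x] does not precede the commit of [y], that commit strictly precedes [x], since [x] is
       not a commit; so the version read by [x] cannot be older than [y]. *)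
    move=> h; apply: contraLR h; rewrite lt_rank -leqNgt leq_eqVlt => h.
    apply: r2 => //; first by rewrite same_tuple_sym.
    rewrite lt_rank; case/orP: h => // /eqP/rank_inj e.
    by have := read_body rx; rewrite -e body_commit_of.
  move=> h; have [->|[wv vx]] := vf_cases rx; first by rewrite vlt_op0.
  have := r1 x rx wv; have vy := same_tuple_trans vx xy => h'.
  have h2 : lt_s s (commit_of (vf s x)) (commit_of y).
    move: h h'; rewrite !lt_rank => h h'.
    exact: ltn_trans h' (leq_trans h (leqnn _)).
  rewrite vC' // diff_transE !write_neq_op0 //=.
  by apply: contraTneq h2 => ->; rewrite lt_rank ltnn.
rewrite /dep; congr [|| _, _ | _].
- by case: ww_conflict Hww => //= ->.
- by case: wr_conflict Hwr => //= ->.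
- by case: rw_conflict Hrw => //= ->.
Qed.

End Schedule.

(** * Schedules from an operation order *)

Section Build.
Variable r : event -> nat.
Hypothesis r_inj : injective r.
Hypothesis r_op0 : forall x, r (op0 T) <= r x.
Hypothesis r_lt_T : forall x y, lt_T x y -> r x < r y.

Section Version.
(* A version [x] counts as installed at [f x]: [f] is the identity for single
   version schedules and [commit_of] for read-last-committed ones. *)
Variable f : event -> event.
Hypothesis f_op0 : f (op0 T) = op0 T.
Hypothesis le_f : forall x, r x <= r (f x).

Lemma schedule_of_rank : exists s,
  [/\ forall x y, le_s s x y = (r x <= r y),
      forall x y, vlt s x y =
        (r (f x) < r (f y)) || (r (f x) == r (f y)) && (r x < r y)
    & forall a, is_read a ->
        (vf s a = op0 T \/ r (f (vf s a)) < r a) /\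
        forall c, is_write c -> same_tuple c a -> r (f c) < r a ->
          ~~ vlt s (vf s a) c].
Proof.
pose N := (\max_(x : event) r x).+1.
have rN x : r x < N by rewrite ltnS; apply: (leq_bigmax x).
pose key x := r (f x) * N + r x.
have keyE x y : (key x < key y) =
    (r (f x) < r (f y)) || (r (f x) == r (f y)) && (r x < r y).
  exact: ltn_lex.
have key_inj x y : key x = key y -> x = y.
  move=> e; apply: r_inj; move: (keyE x y) (keyE y x); rewrite e ltnn.
  by case: ltngtP => //= _; case: ltngtP.
have key0 x : key (op0 T) <= key x.
  by rewrite /key f_op0 leq_add // leq_mul2r r_op0 orbT.
(* [op0] is always a candidate, so the maximum [v a] is well defined. The strict bound hides
   uncommitted writes when [f] is [commit_of], and hides an update from itself when [f] is the
   identity. *)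
pose cand a x :=
  (x == op0 T) || [&& is_write x, same_tuple x a & r (f x) < r a].
pose v a : event := [arg max_(x > op0 T | cand a x) key x].
have vP a : cand a (v a) /\ forall c, cand a c -> key c <= key (v a).
  by rewrite /v; case: arg_maxnP => //; rewrite /cand eqxx.
have v_lt a : is_read a -> r (v a) < r a.
  move=> ra; case: (vP a) => /orP[/eqP -> _|/and3P[_ _ h] _].
    rewrite ltn_neqAle r_op0 andbT (inj_eq r_inj).
    by apply: contraTneq ra => <-.
  exact: leq_ltn_trans h.
have H1 : reflexive (fun x y => r x <= r y) by move=> x /=.
have H2 : antisymmetric (fun x y => r x <= r y).
  by move=> x y; rewrite -eqn_leq => /eqP/r_inj.
have H3 : transitive (fun x y => r x <= r y) by move=> y x z; apply: leq_trans.
have H4 : total (fun x y => r x <= r y) by move=> x y; apply: leq_total.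
pose vl x y := key x < key y.
have H5 t : {in writes_version t, irreflexive vl}.
  by move=> x _; rewrite /vl ltnn.
have H6 t : {in writes_version t & &, transitive vl}.
  by move=> y x z _ _ _; apply: ltn_trans.
have H7 t : {in writes_version t &, forall a b, a != b -> vl a b || vl b a}.
  by move=> x y _ _; rewrite /vl -neq_ltn; apply: contraNneq => /key_inj ->.
have H8 a : is_write a -> vl (op0 T) a.
  move=> wa; rewrite /vl ltn_neqAle key0 andbT.
  by apply: contraTneq wa => /key_inj <-.
have H9 a b : lt_T a b -> (a != b) && (r a <= r b).
  by move=> /r_lt_T h; rewrite ltnW // andbT;
    apply: contraTneq h => ->; rewrite ltnn.
have H10 a : is_read a -> (v a != a) && (r (v a) <= r a).
  move=> /v_lt h; rewrite ltnW // andbT.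
  by apply: contraTneq h => ->; rewrite ltnn.
have H11 a : is_read a -> v a != op0 T -> is_write (v a) && same_tuple (v a) a.
  move=> ra; case: (vP a) => /orP[-> //|/and3P[-> -> _]] //.
exists (Schedule H1 H2 H3 H4 H5 H6 H7 r_op0 H8 H9 H10 H11); split=> //= a ra.
split; first by case: (vP a) => /orP[/eqP|/and3P[_ _]]; [left | right].
move=> c wc ca cr; rewrite /vl -leqNgt; apply: (proj2 (vP a)).
by rewrite /cand wc ca cr orbT.
Qed.
End Version.

Lemma single_version_of_rank : exists2 s, single_version s &
  forall x y, lt_s s x y = (r x < r y).
Proof.
have [s [leE vltE vfE]] :=
  @schedule_of_rank id (erefl _) (fun x => leqnn _).
have ltE x y : lt_s s x y = (r x < r y).
  by rewrite /lt_s leE ltn_neqAle (inj_eq r_inj).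
exists s => //; split=> [a b _ _ _|a ra [c /and4P[wc ca h1 h2]]].
  by rewrite vltE ltE /=; case: ltngtP.
have [_ /(_ c wc ca)] := vfE a ra; rewrite -ltE => /(_ h2).
by rewrite vltE /= -ltE h1.
Qed.

(** Take [commit_of] for [f]: distinct transactions have distinct commits, so ties only concern
    versions written by one transaction. *)
Lemma read_committed_of_rank : exists2 s, read_last_committed s &
  forall x y, le_s s x y = (r x <= r y).
Proof.
have le_f x : r x <= r (commit_of x).
  have [->|x0] := eqVneq x (op0 T); first exact: r_op0.
  have [e|ne] := eqVneq x (commit_of x); first by rewrite -e.
  by apply/ltnW/r_lt_T; rewrite /lt_T ne le_commit_of.
have [s [leE vltE vfE]] := @schedule_of_rank commit_of (erefl _) le_f.
have ltE x y : lt_s s x y = (r x < r y).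
  by rewrite /lt_s leE ltn_neqAle (inj_eq r_inj).
exists s => //; split=> [i j b a ij ib ja _ _ _|a ra].
  rewrite vltE ltE (commit_of_trans ib) (commit_of_trans ja).
  by rewrite (inj_eq r_inj) (inj_eq commit_inj) (negPf ij) orbF.
have [h1 h2] := vfE a ra; split.
  case: h1 => [|h]; first by left.
  case: (vf s a) h => [u|]; last by left.
  by right; exists (tag u); rewrite ?ltE //= eqxx.
case=> k [c /and5P[wc ca kc h h']].
move: h; rewrite -(commit_of_trans kc) ltE => /(h2 c wc ca).
by rewrite h'.
Qed.
End Build.


(** * Serializability and cycles *)

(** The serialization graph of [s]. *)
Definition trans_edge s i j : bool :=
  [exists b, exists a,
    [&& in_trans i b, in_trans j a, conflicting b a & dep s b a]].

Lemma trans_edge_irr s : irreflexive (trans_edge s).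
Proof.
move=> i; apply/negbTE/negP=> /existsP[b /existsP[a /and4P[ib ia]]].
case/conflictingP=> + _ _ _.
by rewrite (in_trans_diff ib ia) eqxx.
Qed.

(** Exchanging [x] and [y] preserves ww-conflicts, swaps wr with rw, and reverses each comparison of
    positions; the positions compared are always distinct, as [x] and [y] are not commits and their
    transactions differ. *)
Lemma dep_total s x y : read_last_committed s -> conflicting x y ->
  dep s x y || dep s y x.
Proof.
move=> rs cxy; rewrite !dep_read_committed // !lt_rank.
have [] := conflictingP cxy; rewrite diff_transE => /and3P[_ _ ne] bx by'.
rewrite (ww_conflict_sym y x) (wr_rw_conflict y x) -(wr_rw_conflict x y).
have n1 : rank s (commit_of x) != rank s (commit_of y).
  by rewrite (inj_eq (@rank_inj s)).
have n2 : rank s (commit_of x) != rank s y.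
  rewrite (inj_eq (@rank_inj s)).
  by apply: contraTneq by' => <-; rewrite body_commit_of.
have n3 : rank s x != rank s (commit_of y).
  rewrite (inj_eq (@rank_inj s)).
  by apply: contraTneq bx => ->; rewrite body_commit_of.
move: cxy; rewrite /conflicting.
case/or3P=> -> /=; move: n1 n2 n3; rewrite !neq_ltn => n1 n2 n3.
- by case/orP: n1 => ->; rewrite ?orbT.
- by case/orP: n2 => ->; rewrite ?orbT.
- by case/orP: n3 => ->; rewrite ?orbT.
Qed.

Lemma serial_of_order (f : I -> nat) : injective f ->
  exists2 s, single_version_serial s &
    forall i j x y, in_trans i x -> in_trans j y -> i != j ->
      lt_s s x y = (f i < f j).
Proof.
move=> f_inj; pose M := \max_i (size (ops (T i))).+1.
(* The successor reserves 0 for [op0]. *)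
pose r x := if x is Some u then (f (tag u) * M + tagged u).+1 else 0.
have tM (u : action T) : tagged u < M.
  exact: leq_trans (ltn_ord _) (leq_bigmax (tag u)).
have r_lt (u v : action T) : r (Some u) < r (Some v) =
    (f (tag u) < f (tag v))
    || (f (tag u) == f (tag v)) && (tagged u < tagged v).
  by rewrite ltnS ltn_lex.
have r_inj : injective r.
  move=> [u|] [v|] // e; have := r_lt u v; have := r_lt v u; rewrite e ltnn.
  case: ltngtP => //= /f_inj.
  case: u v {e} => [i k] [j l] /= e; subst j.
  by case: ltngtP => //= /val_inj ->.
have r_lt_T x y : lt_T x y -> r x < r y.
  by case/lt_TP=> i [k [l [-> -> kl]]]; rewrite r_lt /= ltnn eqxx.
have [s sv ltE] := single_version_of_rank r_inj (fun x => leq0n (r x)) r_lt_T.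
exists s.
  split=> // i [u|] [v|] [w|] //; rewrite !ltE // !r_lt /=.
  move=> h1 h2 /eqP ui /eqP wi.
  subst i; move: h2; rewrite (congr1 f wi) => h2; apply/eqP/f_inj; move: h1 h2.
  by case: ltngtP => //=; case: ltngtP.
move=> i j [u|] [v|] //= /eqP <- /eqP <- ne.
by rewrite ltE r_lt (inj_eq f_inj) (negPf ne) orbF.
Qed.

Lemma serializable_acyclic s : read_last_committed s ->
  (forall i j, trans_edge s i j -> ~~ connect (trans_edge s) j i) ->
  conflict_serializable s.
Proof.
move=> rs acyc; pose e := trans_edge s.
(* Counting ancestors gives a topological numbering: along an edge from [i] to [j] the ancestors of
   [i] remain, and [j] is a new one by acyclicity. *)
pose h i := #|[set j | connect e j i]|.
have h_lt i j : e i j -> h i < h j.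
  move=> ij; apply: proper_card; apply/properP; split.
    apply/subsetP=> k; rewrite !inE => ki.
    exact: connect_trans ki (connect1 ij).
  by exists j; rewrite !inE ?connect0 // acyc.
(* Ties of [h] are broken by [enum_rank], which makes [f] injective. *)
pose f i := h i * #|I| + enum_rank i.
have f_lt i j : e i j -> f i < f j.
  by move=> /h_lt hij; rewrite ltn_lex // hij.
have f_inj : injective f.
  have f_lex i j := ltn_lex (h i) (h j) (ltn_ord (enum_rank i))
    (ltn_ord (enum_rank j)).
  move=> i j eij; have Hij := f_lex i j; have Hji := f_lex j i.
  rewrite -/(f i) -/(f j) eij ltnn in Hij Hji.
  apply/enum_rank_inj/val_inj.
  by move: Hij Hji; case: ltngtP => //= _; case: ltngtP.
have [s' ss' ltE] := serial_of_order f_inj.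
exists s' => // x y cxy; rewrite (dep_single (proj1 ss') cxy).
have [xy bx by'] := conflictingP cxy.
have edgeE u v : conflicting (Some u) (Some v) -> dep s (Some u) (Some v) ->
    e (tag u) (tag v).
  move=> c d; apply/existsP; exists (Some u); apply/existsP; exists (Some v).
  by rewrite c d /= !eqxx.
case: x y cxy xy {bx by'} => [u|] [v|] // cuv uv.
(* When [dep] fails from [u] to [v], totality gives the opposite edge, hence the opposite serial
   order. *)
have := dep_total rs cuv; rewrite (ltE (tag u) (tag v)) //=.
have [d _|_ /= d] := boolP (dep s (Some u) (Some v)).
  by apply/esym/f_lt/edgeE.
apply/esym/negbTE; rewrite -leqNgt ltnW //; apply/f_lt/edgeE => //.
by rewrite conflicting_sym.
Qed.

Lemma not_robust_cycle : ~ robust_RC T ->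
  exists2 s, allowed_RC s & exists c : seq I, shortest_cycle (trans_edge s) c.
Proof.
move=> nr; apply: contrapT => nex; apply: nr => s as'.
apply: serializable_acyclic (proj1 as') _ => i j ij.
apply/negP=> ji; apply: nex.
by exists s => //; apply: shortest_cycle_exists ij ji.
Qed.


(** * Split schedules *)

Lemma T_seq_nth i (k : 'I_(size (ops (T i))).+1) :
  nth (op0 T) (T_seq T i) k = event_at k.
Proof. by rewrite (nth_map k) ?size_enum_ord // nth_ord_enum. Qed.

Lemma size_T_seq i : size (T_seq T i) = (size (ops (T i))).+1.
Proof. by rewrite size_map size_enum_ord. Qed.

Lemma mem_T_seq i x : (x \in T_seq T i) = in_trans i x.
Proof.
apply/mapP/idP=> [[k _ ->]|]; first exact: eqxx.
case: x => [[j k]|] //= /eqP e; subst j.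
by exists k; rewrite ?mem_enum.
Qed.

Lemma T_seq_pairwise i (R : rel event) : pairwise R (T_seq T i) ->
  forall k l : 'I_(size (ops (T i))).+1, k < l -> R (event_at k) (event_at l).
Proof.
move/(pairwiseP (op0 T)) => h k l kl.
by have := h k l; rewrite !inE size_T_seq !T_seq_nth; apply.
Qed.

Lemma lt_T_trans : transitive (@lt_T S I T).
Proof.
move=> y x z /lt_TP[i [k [l [-> -> kl]]]] /lt_TP[j [k' [l' [e -> kl']]]].
have [eij] : i = j by have [] := eqP (introT eqP e).
subst j; move/eqP: e; rewrite /event_at (inj_eq Some_inj) eq_Tagged => /eqP e.
by rewrite lt_T_event_at; apply: ltn_trans kl _; move: (congr1 val e) => /= ->.
Qed.

Lemma lt_T_irr : irreflexive (@lt_T S I T).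
Proof. by move=> x; rewrite /lt_T eqxx. Qed.

Lemma T_seq_sorted i : sorted (@lt_T S I T) (T_seq T i).
Proof.
rewrite sorted_map; apply: (@sub_sorted _ (relpre val ltn)).
  by move=> k l /=; rewrite lt_T_event_at.
by rewrite -sorted_map val_enum_ord iota_ltn_sorted.
Qed.

Lemma T_seq_uniq i : uniq (T_seq T i).
Proof. exact: (sorted_uniq lt_T_trans lt_T_irr (T_seq_sorted i)). Qed.

Lemma lt_T_total i x y : in_trans i x -> in_trans i y -> lt_T x y = ~~ le_T y x.
Proof.
case: x y => [[j k]|] [[j' l]|] //= /eqP e1 /eqP e2; subst j j'.
by rewrite -!/(event_at _) lt_T_event_at /= eqxx -ltnNge.
Qed.

(** Both sides are sorted by the strict order [lt_T] and have the same entries. *)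
Lemma prefix_postfix i b : in_trans i b ->
  prefix_T b i ++ postfix_T b i = T_seq T i.
Proof.
move=> ib; apply: (irr_sorted_eq lt_T_trans lt_T_irr _ (T_seq_sorted i)).
  rewrite (sorted_pairwise lt_T_trans) pairwise_cat.
  have := T_seq_sorted i; rewrite (sorted_pairwise lt_T_trans) => h.
  rewrite !pairwise_filter //= andbT; apply/allrelP=> x y.
  rewrite !mem_filter => /andP[xb xi] /andP[bxy _].
  have [->|ne] := eqVneq x b; first by [].
  by apply: lt_T_trans bxy; rewrite /lt_T ne.
move=> x; rewrite mem_cat !mem_filter -andb_orl andb_idl // mem_T_seq => ix.
by rewrite (lt_T_total ib ix) orbN.
Qed.

Definition block (l : seq I) : seq event := flatten [seq T_seq T i | i <- l].

Lemma mem_block l x :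
  (x \in block l) = if x is Some u then tag u \in l else false.
Proof.
apply/flatten_mapP/idP=> [[i il]|]; rewrite ?mem_T_seq.
  by case: x => //= u /eqP ->.
by case: x => // u ul; exists (tag u); rewrite ?mem_T_seq //= eqxx.
Qed.

Lemma in_block i l x : in_trans i x -> i \in l -> x \in block l.
Proof. by rewrite mem_block; case: x => // u /eqP ->. Qed.

Lemma block_uniq l : uniq l -> uniq (block l).
Proof.
elim: l => //= i l IH /andP[il ul].
rewrite /block /= cat_uniq T_seq_uniq IH //= andbT.
apply/hasPn=> -[u|]; rewrite mem_block // mem_T_seq /= => ul'.
by apply: contraNneq il => <-.
Qed.

Lemma block_cat l1 l2 : block (l1 ++ l2) = block l1 ++ block l2.
Proof. by rewrite /block map_cat flatten_cat. Qed.

Lemma subseq_block i l : i \in l -> subseq (T_seq T i) (block l).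
Proof.
case/splitPr=> l1 l2; rewrite block_cat /block /=.
by apply: subseq_trans (suffix_subseq _ _); apply: prefix_subseq.
Qed.

(** Only the operation order is prescribed, so a single version schedule ranked by the index in the
    list will do. *)
Lemma op_sequence_exists (L : seq event) : uniq (op0 T :: L) ->
  (forall x, x \in op0 T :: L) -> (forall i, subseq (T_seq T i) L) ->
  exists s, op_sequence s = op0 T :: L.
Proof.
set L0 := op0 T :: L => uL memL subL; pose r x := index x L0.
have r_inj : injective r by move=> x y; apply: (index_inj x).
have pL : pairwise (relpre r ltn) L0.
  apply/(pairwiseP (op0 T)) => k l kL lL kl /=.
  by rewrite /r !index_uniq.
have r_lt_T x y : lt_T x y -> r x < r y.
  case/lt_TP=> i [k [l [-> -> kl]]].
  have : pairwise (relpre r ltn) (T_seq T i).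
    apply: subseq_pairwise pL; apply: subseq_trans (subL i) _.
    exact: subseq_cons.
  by move/T_seq_pairwise/(_ k l kl).
(* [op0] heads the list, so its index computes to 0. *)
have r0 x : r (op0 T) <= r x by [].
have [s _ ltE] := single_version_of_rank r_inj r0 r_lt_T.
exists s; apply: (sorted_eq (@le_s_trans _ _ _ s) (@le_s_anti _ _ _ s)).
- exact/sort_sorted/le_s_total.
- apply: pairwise_sorted; apply: sub_pairwise pL => x y /=.
  by rewrite -ltE => /andP[].
- apply: uniq_perm => // [|x]; first exact: op_sequence_uniq.
  by rewrite mem_op_sequence memL.
Qed.

(** The list is a permutation of a serial arrangement, so it has each event once; splitting the
    transaction [i] at [b] keeps it a subsequence. *)
Lemma split_order_exists i b (l l' : seq I) : in_trans i b ->
  uniq (i :: l) -> uniq l' -> (forall j, (j \in l') = (j \notin i :: l)) ->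
  exists s, op_sequence s =
    op0 T :: prefix_T b i ++ block l ++ postfix_T b i ++ block l'.
Proof.
move=> ib ul ul' meml'; set L := prefix_T b i ++ _.
have perm_L : perm_eq L (block (i :: l ++ l')).
  have -> : block (i :: l ++ l') = T_seq T i ++ block (l ++ l') by [].
  by rewrite -(prefix_postfix ib) -catA perm_cat2l block_cat perm_catCA.
have ull : uniq (i :: l ++ l').
  rewrite -cat_cons cat_uniq ul ul' andbT; apply/hasPn=> j.
  by rewrite meml'.
have memL x : x \in op0 T :: L.
  rewrite inE (perm_mem perm_L) mem_block; case: x => // u; apply/orP; right.
  by rewrite -cat_cons mem_cat meml' orbN.
apply: op_sequence_exists => // [|j].
  rewrite /= (perm_uniq perm_L) block_uniq // andbT.
  by rewrite (perm_mem perm_L) mem_block.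
have [->|ji] := eqVneq j i.
  rewrite -(prefix_postfix ib); apply: cat_subseq => //.
  by apply: subseq_trans (suffix_subseq _ _); apply: prefix_subseq.
apply: subseq_trans (suffix_subseq _ _).
have [jl|jl] := boolP (j \in l).
  exact: subseq_trans (subseq_block jl) (prefix_subseq _ _).
rewrite catA; apply: subseq_trans (suffix_subseq _ _); apply: subseq_block.
by rewrite meml' inE negb_or ji.
Qed.


(** * From a split schedule to non-robustness *)

Lemma op_sequence_before s (A B : seq event) x y :
  op_sequence s = A ++ B -> x \in A -> y \in B -> lt_s s x y.
Proof.
move=> eL xA yB; rewrite lt_rank.
have : pairwise (relpre (rank s) ltn) (op_sequence s).
  apply/(pairwiseP (op0 T)) => k l kL lL kl /=.
  by rewrite /rank !index_uniq // op_sequence_uniq.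
by rewrite eL pairwise_cat => /and3P[/allrelP h _ _]; apply: h.
Qed.

Lemma op_sequence_contiguous s (A B : seq event) i x y :
  op_sequence s = A ++ T_seq T i ++ B -> in_trans i x ->
  lt_s s x y -> lt_s s y (commit T i) -> in_trans i y.
Proof.
move=> eL ix; rewrite !lt_rank => xy yi; rewrite -mem_T_seq.
have := mem_op_sequence s y; rewrite eL !mem_cat => /or3P[yA|//|yB].
  have := op_sequence_before (x := y) (y := x) eL yA.
  by rewrite mem_cat !mem_T_seq ix lt_rank ltnNge (ltnW xy) => /(_ isT).
rewrite catA in eL; have := op_sequence_before (x := commit T i) eL _ yB.
rewrite mem_cat !mem_T_seq in_trans_commit orbT lt_rank ltnNge (ltnW yi).
by move/(_ isT).
Qed.

(** Were C_j before C_i, then C_j would lie between [x] and C_i, hence belong to T_i. *)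
Lemma serial_lt_commit s i j x y : single_version_serial s ->
  in_trans i x -> in_trans j y -> i != j -> lt_s s x y ->
  lt_s s (commit T i) (commit T j).
Proof.
case=> _ ser ix jy ij xy; rewrite lt_rank ltn_neqAle (inj_eq (@rank_inj s)).
rewrite (inj_eq commit_inj) ij leqNgt /= -lt_rank; apply/negP=> ji.
suff : in_trans i (commit T j) by rewrite /= eq_sym (negPf ij).
apply: ser ji ix (in_trans_commit i); rewrite lt_rank.
rewrite lt_rank in xy; apply: leq_trans xy _.
by rewrite -(commit_of_trans jy) rank_commit.
Qed.

(** The assumption is the strongest of the three comparisons in [dep_read_committed], so the kind of
    conflict does not matter. *)
Lemma dep_commit_before s x y : read_last_committed s -> conflicting x y ->
  lt_s s (commit_of x) y -> dep s x y.
Proof.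
move=> rs cxy lxy; rewrite dep_read_committed // lxy.
have := rank_commit s x; have := rank_commit s y.
rewrite lt_rank in lxy; move=> ly lx.
rewrite !lt_rank (leq_trans lxy ly) (leq_ltn_trans lx (leq_trans lxy ly)).
by rewrite !andbT.
Qed.

(* Quadruples contain elements of a schema and proofs: their decidable equality
   is classical. *)
HB.instance Definition _ := gen_eqMixin (quadruple T).

Lemma increasing_no_cycle (g : I -> nat) (C : seq (quadruple T)) : C != [::] ->
  cycle (fun q q' => tgt q == src q') C ->
  ~ {in C, forall q, g (src q) < g (tgt q)}.
Proof.
case: C => // q C _ cyc lt_g.
have : path (relpre (g \o @src _ _ _) ltn) q (rcons C q).
  apply: (sub_in_path (P := mem (q :: C))) cyc => [q1 q2 q1C _ /eqP e|].
    by rewrite /= -e; apply: lt_g.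
  by apply/allP=> z; rewrite !inE mem_rcons inE orbA orbb.
move/(order_path_min (fun y x z : quadruple T => @ltn_trans _ _ _)).
move=> /allP/(_ q).
by rewrite mem_rcons mem_head /= ltnn => /(_ isT).
Qed.

Lemma split_schedule_not_robust (C : seq (quadruple T)) s :
  split_schedule C s -> ~ robust_RC T.
Proof.
case: C => // q1 C'; rewrite /split_schedule.
set i1 := src q1; set b1 := opb q1; set mid := map _ C'.
case=> -[cyc _] [oth [_ memoth]].
rewrite -!/(block _) => eL no_ww cond2 rw1 rob.
(* The versions of [s] are arbitrary; [s'] keeps its operation order and reads the last committed
   versions. *)
have [s' rs' leE] :=
  read_committed_of_rank (@rank_inj s) (rank_op0 s) (@rank_lt_T s).
have ltE x y : lt_s s' x y = lt_s s x y.
  by rewrite /lt_s leE le_rank.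
have b1i : in_trans i1 b1 := opb_src q1.
have b1P : b1 \in prefix_T b1 i1.
  rewrite mem_filter mem_T_seq b1i andbT.
  by case: (b1) b1i => //= u _; rewrite eqxx leqnn.
have c1Q : commit T i1 \in postfix_T b1 i1.
  rewrite mem_filter mem_T_seq in_trans_commit andbT.
  rewrite (lt_T_total b1i (in_trans_commit i1)).
  have [_ bb _] := conflictingP (quad_conflict q1).
  apply: contraL bb; rewrite -/b1; case: (b1) => //= u /andP[/eqP e le_u].
  by rewrite e in le_u; rewrite onthE nth_default // size_map.
have ePM : op_sequence s =
  (op0 T :: prefix_T b1 i1) ++ (block mid ++ postfix_T b1 i1 ++ block oth).
  by rewrite eL.
have eMQ : op_sequence s =
  (op0 T :: prefix_T b1 i1 ++ block mid) ++ (postfix_T b1 i1 ++ block oth).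
  by rewrite eL /= catA.
have eQO : op_sequence s =
  (op0 T :: prefix_T b1 i1 ++ block mid ++ postfix_T b1 i1) ++ block oth.
  by rewrite eL /= !catA.
have ltPM x y : x \in prefix_T b1 i1 -> y \in block mid -> lt_s s x y.
  move=> xP yM; apply: (op_sequence_before ePM);
    by rewrite ?inE ?xP ?orbT // mem_cat yM.
have ltMQ x y : x \in block mid -> y \in postfix_T b1 i1 -> lt_s s x y.
  move=> xM yQ; apply: (op_sequence_before eMQ);
    by rewrite ?inE mem_cat ?xM ?yQ ?orbT.
have ltQO x y : x \in postfix_T b1 i1 -> y \in block oth -> lt_s s x y.
  move=> xQ yO; apply: (op_sequence_before eQO) => //;
    by rewrite inE !mem_cat xQ !orbT.
have not_both x y : lt_s s x y -> lt_s s y x -> False.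
  by rewrite !lt_rank => h h'; have := ltn_trans h h'; rewrite ltnn.
have no_dirty : ~ exhibits_dirty_write s'.
  case=> i [b [a /and4P[ib wwba]]]; rewrite !ltE => ba ai.
  have [dba _ wb wa] := ww_conflictP wwba.
  (* The overwriting [a] falls between [b] and C_i, which is impossible if T_i is contiguous. This
     leaves only T_1. *)
  have contig A B : op_sequence s = A ++ T_seq T i ++ B -> False.
    move=> e; have := op_sequence_contiguous e ib ba ai.
    by move=> ia; move: dba; rewrite (in_trans_diff ib ia) eqxx.
  have [imid|inmid] := boolP (i \in mid).
    case/splitPr: imid eL {no_ww eMQ ePM eQO ltPM ltMQ memoth} => l1 l2.
    rewrite block_cat -[block (i :: l2)]/(T_seq T i ++ block l2) => e.
    apply: (contig (op0 T :: prefix_T b1 i1 ++ block l1)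
      (block l2 ++ postfix_T b1 i1 ++ block oth)).
    by rewrite e /= !catA.
  have [ioth|inoth] := boolP (i \in oth).
    case/splitPr: ioth eL {no_ww eMQ ePM eQO ltQO memoth} => l1 l2.
    rewrite block_cat -[block (i :: l2)]/(T_seq T i ++ block l2) => e.
    apply: (contig (op0 T :: prefix_T b1 i1 ++ block mid ++ postfix_T b1 i1
      ++ block l1) (block l2)).
    by rewrite e /= !catA.
  move: inoth; rewrite memoth negbK inE -/mid (negPf inmid) orbF => /eqP e.
  rewrite e -/i1 in ib ai.
  have bPQ : b \in prefix_T b1 i1 ++ postfix_T b1 i1.
    by rewrite prefix_postfix // mem_T_seq.
  have aT : a \notin T_seq T i1.
    rewrite mem_T_seq; apply/negP=> ia; move: dba.
    by rewrite (in_trans_diff ib ia) eqxx.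
  (* As [a] precedes C_1 and lies outside T_1, it is in the middle; then [b], preceding it, is in
     the prefix, against condition (1). *)
  have aM : a \in block mid.
    have := mem_op_sequence s a; rewrite eL inE !mem_cat.
    have a0 : a == op0 T = false by apply/negbTE/write_neq_op0.
    rewrite a0 /=; move: aT; rewrite -(prefix_postfix b1i) mem_cat negb_or.
    case/andP=> /negPf -> /negPf -> /=; case/orP=> // aO.
    by have := not_both _ _ ai (ltQO _ _ c1Q aO).
  have bP : b \in prefix_T b1 i1.
    move: bPQ; rewrite mem_cat => /orP[//|bQ].
    by have := not_both _ _ ba (ltMQ _ _ aM bQ).
  case: a aM {aT ba ai} dba wa wwba => // u aM dba wa wwba.
  rewrite mem_block in aM; have := no_ww b (tag u) (Some u) bP wb aM.
  by rewrite wwba => /(_ (eqxx _) wa).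
have [s2 ser eqv] := rob s' (conj rs' no_dirty).
(* In an equivalent serial schedule the commits would increase strictly all along the cycle [C]. *)
apply: (increasing_no_cycle (g := rank s2 \o commit T) _ cyc) => // q qC.
have cq := quad_conflict q.
rewrite /= -lt_rank.
apply: (serial_lt_commit ser (opb_src q) (opa_tgt q) (src_neq_tgt q)).
rewrite -(dep_single (proj1 ser)) // -eqv //.
move: qC; rewrite inE => /orP[/eqP ->|].
  rewrite dep_read_committed //; apply/or3P/Or33; rewrite rw1 ltE /=.
  apply: ltPM => //; rewrite (commit_of_trans (opa_tgt q1)).
  apply: in_block (in_trans_commit _) _.
  (* A single quadruple would have to close up on itself, but its source and target differ. *)
  move: cyc; rewrite /mid /=; case: (C') => [|q2 D] /= /andP[/eqP e _].
    by have := src_neq_tgt q1; rewrite e eqxx.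
  by rewrite e mem_head.
case/splitPr eC: _ / => [D1 D2].
have qmid : src q \in mid by rewrite /mid eC map_cat mem_cat /= mem_head orbT.
move: cyc; rewrite eC /= rcons_cat cat_path /= => /and3P[_ _].
(* The last quadruple, which returns to T_1, is handled by condition (2). *)
case: D2 eC => [|q2 D2] eC /= /andP[/eqP eq2 _].
  have elast : last q1 C' = q by rewrite eC last_cat.
  rewrite elast in cond2; case/orP: cond2 => [lt|rw].
    apply: dep_commit_before => //; rewrite ltE (commit_of_trans (opb_src q)).
    apply: ltMQ; first exact: in_block (in_trans_commit _) qmid.
    by rewrite mem_filter lt mem_T_seq -[i1]eq2 (opa_tgt q).
  rewrite dep_read_committed //; apply/or3P/Or33; rewrite rw ltE /=.
  rewrite (commit_of_trans (opa_tgt q)) eq2; apply: ltMQ => //.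
  exact: in_block (opb_src q) qmid.
(* For an inner quadruple the whole target transaction comes after the source in the middle part. *)
apply: dep_commit_before => //; rewrite ltE (commit_of_trans (opb_src q)).
pose m1 := map (@src _ _ T) D1; pose m2 := map (@src _ _ T) D2.
have emid : mid = m1 ++ [:: src q] ++ src q2 :: m2.
  by rewrite /mid eC map_cat.
rewrite emid !block_cat in eL.
apply: (@op_sequence_before s
  (op0 T :: prefix_T b1 i1 ++ block m1 ++ block [:: src q])
  (block (src q2 :: m2) ++ postfix_T b1 i1 ++ block oth)).
- by rewrite eL /= !catA.
- by rewrite inE !mem_cat mem_T_seq in_trans_commit !orbT.
- rewrite mem_cat -eq2; apply/orP; left.
  exact: in_block (opa_tgt q) (mem_head _ _).
Qed.

(** * From a shortest cycle to a split schedule *)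

Lemma edge_quadruple s i j : trans_edge s i j ->
  exists q : quadruple T, [/\ src q = i, tgt q = j & dep s (opb q) (opa q)].
Proof.
case/existsP=> b /existsP[a /and4P[ib ja cba dba]].
have ij : i != j.
  by have [+ _ _] := conflictingP cba; rewrite (in_trans_diff ib ja).
by exists (Quadruple ij ib ja cba).
Qed.

Lemma path_quadruples s i p j : path (trans_edge s) i (rcons p j) ->
  exists C : seq (quadruple T), [/\ map (@src _ _ _) C = i :: p,
    map (@tgt _ _ _) C = rcons p j
  & {in C, forall q, dep s (opb q) (opa q)}].
Proof.
elim: p i => [|k p IH] i /=.
  case/andP=> /edge_quadruple[q [<- <- d]] _.
  by exists [:: q]; split=> // q'; rewrite inE => /eqP ->.
case/andP=> /edge_quadruple[q [<- <- d]] /IH[C [eS eT dC]].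
exists (q :: C); split; rewrite /= ?eS ?eT // => q'.
by rewrite inE => /orP[/eqP ->|/dC].
Qed.


(** [path_quadruples] only records the lists of sources and targets; the linking required by
    [quad_sequence] is recovered from them here. *)
Lemma path_of_maps (q r : quadruple T) (C : seq (quadruple T)) :
  map (@tgt _ _ _) (q :: C) = rcons (map (@src _ _ _) C) (src r) ->
  path (fun q q' => tgt q == src q') q (rcons C r).
Proof.
elim: C q => [|q' C IH] q /=; first by case=> ->; rewrite eqxx.
by case=> -> /IH ->; rewrite eqxx.
Qed.

Lemma not_robust_split_schedule : ~ robust_RC T ->
  exists (C : seq (quadruple T)) s, split_schedule C s.
Proof.
case/not_robust_cycle=> s [rs no_dirty] [c0 sc0].
pose R i := rank s (commit T i).
have [i1 [i2 [p [sc Rmin]]]] := shortest_cycle_min R (trans_edge_irr s) sc0.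
have uc := shortest_cycle_uniq sc; case: (sc) => cyc _ _.
have {cyc} : path (trans_edge s) i1 (rcons (i2 :: p) i1) by [].
case/path_quadruples=> -[|q1 C'] [] // [eq1 eS] eT dC.
have [et1 eT'] : tgt q1 = i2 /\ map (@tgt _ _ _) C' = rcons p i1 by case: eT.
pose b1 := opb q1; have b1i : in_trans i1 b1 by rewrite -eq1 (opb_src q1).
set oth := [seq i <- enum I | i \notin [:: i1, i2 & p]].
have memoth i : (i \in oth) = (i \notin [:: i1, i2 & p]).
  by rewrite mem_filter mem_enum andbT.
have uoth : uniq oth by rewrite filter_uniq ?enum_uniq.
have [s' es'] := split_order_exists b1i uc uoth memoth.
have rank_leT x y : le_T x y -> rank s x <= rank s y.
  have [->//|ne xy] := eqVneq x y.
  by apply/ltnW/rank_lt_T; rewrite /lt_T ne.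
have lt_commit i x : body x -> rank s x <= R i -> rank s x < R i.
  rewrite /R leq_eqVlt (inj_eq (@rank_inj s)) => bx /orP[/eqP e|//].
  by rewrite e (body_commit_of (commit T i)) in bx.
(* Absence of dirty writes in positive form: the earlier writer commits before the later write. *)
have no_dw i b a : in_trans i b -> ww_conflict b a -> rank s b < rank s a ->
    R i < rank s a.
  move=> ib wwba lba; rewrite ltnNge; apply/negP=> h; apply: no_dirty.
  exists i, b, a; rewrite ib wwba !lt_rank lba /=; apply: lt_commit => //.
  by have [_ _ _ /write_body] := ww_conflictP wwba.
have depE q : q \in q1 :: C' ->
    [|| ww_conflict (opb q) (opa q) && (R (src q) < R (tgt q)),
        wr_conflict (opb q) (opa q) && (R (src q) < rank s (opa q))
      | rw_conflict (opb q) (opa q) && (rank s (opb q) < R (tgt q))].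
  move/dC; rewrite dep_read_committed // !lt_rank.
  by rewrite (commit_of_trans (opb_src q)) (commit_of_trans (opa_tgt q)).
have R21 : R i2 <= R i1 by apply: Rmin; rewrite mem_head.
have le_R i x : in_trans i x -> rank s x <= R i.
  by move=> /commit_of_trans e; rewrite /R -e rank_commit.
(* A ww- or wr-dependency would make T_1 commit before T_2, against the choice of [i2]. *)
have [rw1 lt12] : rw_conflict b1 (opa q1) /\ rank s b1 < R i2.
  have := depE q1 (mem_head _ _); rewrite et1 eq1 => /or3P[] /andP[] //.
    by rewrite ltnNge R21.
  move=> _ h; have := le_R _ _ (opa_tgt q1).
  by rewrite et1 leqNgt (leq_ltn_trans R21 h).
have b1_lt k : k \in i2 :: p -> rank s b1 < R k.
  by move=> kp; apply: leq_trans lt12 _; apply: Rmin; rewrite inE kp orbT.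
have no_ww c k d : rank s c <= rank s b1 -> in_trans i1 c -> k \in i2 :: p ->
    in_trans k d -> ~~ ww_conflict c d.
  move=> cb ic kp kd; apply/negP=> wwcd.
  have [dcd _ /write_body bc /write_body bd] := ww_conflictP wwcd.
  have lcd : rank s c < rank s d.
    rewrite ltn_neqAle (inj_eq (@rank_inj s)); apply/andP; split.
      by apply: contraTneq dcd => ->; rewrite diff_transE eqxx !andbF.
    (* If [d] came first, T_k would commit before [c], hence before [b1], but [b1] precedes every
       commit of T_2, ..., T_m. *)
    rewrite leqNgt; apply/negP=> ldc.
    rewrite ww_conflict_sym in wwcd; have := no_dw _ _ _ kd wwcd ldc.
    by rewrite ltnNge (leq_trans cb) // ltnW // b1_lt.
  have lkd : R i1 < R k := leq_trans (no_dw _ _ _ ic wwcd lcd) (le_R _ _ kd).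
  (* [c ->_s d] would be a chord of the shortest cycle. *)
  have e1k : trans_edge s i1 k.
    apply/existsP; exists c; apply/existsP; exists d.
    rewrite ic kd /conflicting wwcd dep_read_committed // wwcd !lt_rank.
    by rewrite (commit_of_trans ic) (commit_of_trans kd) -/(R i1) -/(R k) lkd.
  (* Nothing lies between T_1 and T_k on the cycle, so [k] is [i2], which does not commit after
     T_1. *)
  case/splitPr ek : _ / kp => [l1 l2]; rewrite ek in sc.
  have l10 := shortest_cycle_chord sc e1k.
  move: ek; rewrite l10 /= => -[ei2 _].
  by move: lkd; rewrite -ei2 ltnNge R21.
exists (q1 :: C'), s'; rewrite /split_schedule -/(block _) eS eq1.
have eL : last q1 C' \in q1 :: C' := mem_last _ _.
have srcL : src (last q1 C') \in i2 :: p.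
  case: C' eS {eT eT' dC depE eL} => // q2 C' <-.
  by apply: map_f; exact: (mem_last q2 C').
have tgtL : tgt (last q1 C') = i1.
  have := congr1 (last i1) eT; rewrite last_rcons /= => <-.
  by rewrite (last_map (@tgt _ _ _)).
split=> //.
- split.
    apply: path_of_maps; rewrite /= et1 eT' eS eq1.
    by [].
  (* The cycle has no repetition, so each id is at most once a source and at most once a target. *)
  move=> i; pose f := preim (@src _ _ T) (pred1 i).
  pose g := preim (@tgt _ _ T) (pred1 i).
  apply: (@leq_trans (count f (q1 :: C') + count g (q1 :: C'))).
    by rewrite -count_predUI; apply: leq_addr.
  rewrite -!count_map eT.
  rewrite (_ : map _ _ = [:: i1, i2 & p]); last by rewrite /= eq1 eS.
  rewrite !count_uniq_mem // ?rcons_uniq; last exact: uc.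
  by case: (_ \in _); case: (_ \in _).
- exists oth; split=> // i; by rewrite memoth /= eq1 eS.
- move=> c k d; rewrite mem_filter mem_T_seq => /andP[cb ic] _ kp kd _.
  exact: no_ww (rank_leT _ _ cb) ic kp kd.
(* Suppose a_1 is not after b_1 and the last dependency is not rw. Then ww contradicts [no_ww], and
   wr would have T_m commit before a_1, hence before b_1. *)
case: (boolP (rw_conflict _ _)) => [_|nrw]; first by rewrite orbT.
rewrite orbF; set a1 := opa _.
have a1i : in_trans i1 a1 by rewrite -tgtL opa_tgt.
rewrite (lt_T_total b1i a1i); apply/negP=> /rank_leT le_ab.
have := depE _ eL; rewrite (negPf nrw) orbF -/a1 => /orP[/andP[ww _]|/andP[_]].
  rewrite ww_conflict_sym in ww.
  by have := no_ww _ _ _ le_ab a1i srcL (opb_src _); rewrite ww.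
by rewrite ltnNge (leq_trans le_ab) // ltnW // b1_lt.
Qed.

End Robustness.

Theorem theorem7 (S : schema) (I : finType) (T : I -> transaction S) :
  ~ robust_RC T <->
  exists (C : seq (quadruple T)) (s : schedule T), split_schedule C s.
Proof.
split; first exact: not_robust_split_schedule.
by case=> C [s]; apply: split_schedule_not_robust.
Qed.
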